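(* There is no linear change of variables of the form $\tilde{x}=ax+by$, $\tilde{y}=cx+dy$ with $a,b,c,d\in\mathbb{R}$ and $ad-bc\neq 0$ for which $$\Delta_{x,y}^2u=(\partial_{\tilde{x}}^4+\partial_{\tilde{y}}^4)u$$ holds (for all smooth functions $u$ on the plane).
   Context: $\Delta_{x,y}^2u=\partial_x^4u+2\partial_x^2\partial_y^2u+\partial_y^4u$ is the biharmonic operator in the variables $(x,y)\in\mathbb{R}^2$. On the right hand side, $u$ is regarded as a function of $(\tilde x,\tilde y)$ through the invertible change of variables. *)

(* Defs.v *)
From Stdlib Require Import Reals Lra.
From Coquelicot Require Import Coquelicot.
Open Scope R_scope.

(** Functions on the plane are curried, [R -> R -> R], as in Coquelicot's
    [Derive_2d]. [ex_diff_n u n x y] bundles existence and continuity of all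
    iterated partial derivatives of [u] of order at most [n] at [(x, y)], so
    [smooth2 u] says that [u] is C^infinity on R^2. *)
Definition smooth2 (u : R -> R -> R) : Prop :=
  forall (n : nat) (x y : R), ex_diff_n u n x y.

(** [partial_derive m k u] differentiates [k] times in the second variable and
    then [m] times in the first. *)
Definition biharmonic (u : R -> R -> R) (x y : R) : R :=
  partial_derive 4 0 u x y + 2 * partial_derive 2 2 u x y
  + partial_derive 0 4 u x y.

Definition sum_fourth_derivs (v : R -> R -> R) (X Y : R) : R :=
  partial_derive 4 0 v X Y + partial_derive 0 4 v X Y.

(** [u] as a function of the new variables [X = a x + b y], [Y = c x + d y]:
    the old ones are recovered from them by Cramer's rule
    (see [in_new_variablesE]). *)
Definition in_new_variables (a b c d : R) (u : R -> R -> R) (X Y : R) : R :=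
  u ((d * X - b * Y) / (a * d - b * c)) ((a * Y - c * X) / (a * d - b * c)).

Lemma in_new_variablesE (a b c d : R) (u : R -> R -> R) (x y : R) :
  a * d - b * c <> 0 ->
  in_new_variables a b c d u (a * x + b * y) (c * x + d * y) = u x y.
Proof.
  intros Hdet; unfold in_new_variables.
  f_equal; field; exact Hdet.
Qed.

(* Main.v *)
(** The test function [u = X^2 Y^2], with [X = a x + b y] and [Y = c x + d y],
    is annihilated by [d_X^4 + d_Y^4], whereas its bilaplacian is the constant
    [8 (a^2 + b^2) (c^2 + d^2) + 16 (a c + b d)^2]. This is positive, because
    [(a, b)] and [(c, d)] are nonzero when [a d - b c <> 0]. *)
Require Import Defs.
From Stdlib Require Import Reals Lra.
From Coquelicot Require Import Coquelicot.
Open Scope R_scope.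

(** A class of functions closed under both partial derivatives, introduced only to obtain smoothness
    by induction. Membership is tied to the shape of the function up to conversion, so later uses
    often name the summands or factors explicitly. *)
Inductive polynomial2 : (R -> R -> R) -> Prop :=
| polynomial2_const (k : R) : polynomial2 (fun _ _ => k)
| polynomial2_fst : polynomial2 (fun x _ => x)
| polynomial2_snd : polynomial2 (fun _ y => y)
| polynomial2_plus f g :
    polynomial2 f -> polynomial2 g -> polynomial2 (fun x y => f x y + g x y)
| polynomial2_mult f g :
    polynomial2 f -> polynomial2 g -> polynomial2 (fun x y => f x y * g x y).

Lemma polynomial2_continuity (f : R -> R -> R) (x y : R) :
  polynomial2 f -> continuity_2d_pt f x y.
Proof.
  induction 1 as [k| | |f g _ IHf _ IHg|f g _ IHf _ IHg].
  - apply continuity_2d_pt_const.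
  - apply continuity_2d_pt_id1.
  - apply continuity_2d_pt_id2.
  - now apply continuity_2d_pt_plus.
  - now apply continuity_2d_pt_mult.
Qed.

Lemma polynomial2_swap (f : R -> R -> R) :
  polynomial2 f -> polynomial2 (fun x y => f y x).
Proof.
  induction 1.
  - apply polynomial2_const.
  - apply polynomial2_snd.
  - apply polynomial2_fst.
  - now apply (polynomial2_plus (fun x y => f y x) (fun x y => g y x)).
  - now apply (polynomial2_mult (fun x y => f y x) (fun x y => g y x)).
Qed.

(** The sum and product rules keep the derivative inside the class, so differentiation can be
    iterated. *)
Lemma polynomial2_derive_fst (f : R -> R -> R) :
  polynomial2 f ->
  exists f', polynomial2 f' /\
    forall x y, is_derive (fun z => f z y) x (f' x y).
Proof.
  induction 1 as [k| | |f g Pf [f' [Pf' Df]] Pg [g' [Pg' Dg]]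
                       |f g Pf [f' [Pf' Df]] Pg [g' [Pg' Dg]]].
  - exists (fun _ _ => 0); split; [apply polynomial2_const|].
    intros x y; apply @is_derive_const.
  - exists (fun _ _ => 1); split; [apply polynomial2_const|].
    intros x y; apply @is_derive_id.
  - exists (fun _ _ => 0); split; [apply polynomial2_const|].
    intros x y; apply @is_derive_const.
  - exists (fun x y => f' x y + g' x y); split.
    + now apply polynomial2_plus.
    + intros x y.
      now apply @is_derive_plus.
  - exists (fun x y => f' x y * g x y + f x y * g' x y); split.
    + apply (polynomial2_plus (fun x y => f' x y * g x y)
                              (fun x y => f x y * g' x y));
        now apply polynomial2_mult.
    + intros x y.
      apply (is_derive_mult (fun z => f z y) (fun z => g z y));
        [apply Df|apply Dg|exact Rmult_comm].
Qed.

Lemma polynomial2_derive_snd (f : R -> R -> R) :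
  polynomial2 f ->
  exists f', polynomial2 f' /\
    forall x y, is_derive (fun z => f x z) y (f' x y).
Proof.
  intros Pf.
  destruct (polynomial2_derive_fst _ (polynomial2_swap _ Pf)) as [f' [Pf' Df]].
  exists (fun x y => f' y x); split; [now apply polynomial2_swap|].
  intros x y; apply Df.
Qed.

(** Induction on the order, with [f] general: both partial derivatives are again polynomial, so the
    induction hypothesis applies to them. *)
Lemma polynomial2_smooth2 (f : R -> R -> R) : polynomial2 f -> smooth2 f.
Proof.
  intros Pf n; revert f Pf.
  induction n as [|n IHn]; intros f Pf x y.
  - split; [now apply polynomial2_continuity|exact I].
  - destruct (polynomial2_derive_fst f Pf) as [f1 [P1 D1]].
    destruct (polynomial2_derive_snd f Pf) as [f2 [P2 D2]].
    simpl; refine (conj _ (conj _ (conj _ (conj _ _)))).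
    + now apply polynomial2_continuity.
    + exists (f1 x y); apply D1.
    + exists (f2 x y); apply D2.
    + apply ex_diff_n_ext_loc with f1; [|now apply IHn].
      (* [f1] equals the [Derive] expression everywhere, so any radius serves. *)
      exists (mkposreal 1 Rlt_0_1); intros s t _ _.
      symmetry; apply is_derive_unique, D1.
    + apply ex_diff_n_ext_loc with f2; [|now apply IHn].
      exists (mkposreal 1 Rlt_0_1); intros s t _ _.
      symmetry; apply is_derive_unique, D2.
Qed.

(** Quartics suffice because the test function has degree at most 4 in each variable separately. The
    pointwise hypothesis leaves the expansion into coefficients to [ring]. *)
Lemma Derive_n_2_quartic (f : R -> R) (p0 p1 p2 p3 p4 x : R) :
  (forall t, f t = p0 + p1 * t + p2 * t ^ 2 + p3 * t ^ 3 + p4 * t ^ 4) ->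
  Derive_n f 2 x = 2 * p2 + 6 * p3 * x + 12 * p4 * x ^ 2.
Proof.
  intros Hf; rewrite (Derive_n_ext _ _ 2 x Hf); simpl.
  rewrite (Derive_ext _ (fun t => p1 + 2 * p2 * t + 3 * p3 * t ^ 2
                                  + 4 * p4 * t ^ 3)).
  - apply is_derive_unique; auto_derive; trivial; ring.
  - intros t; apply is_derive_unique; auto_derive; trivial; ring.
Qed.

Lemma Derive_n_4_quartic (f : R -> R) (p0 p1 p2 p3 p4 x : R) :
  (forall t, f t = p0 + p1 * t + p2 * t ^ 2 + p3 * t ^ 3 + p4 * t ^ 4) ->
  Derive_n f 4 x = 24 * p4.
Proof.
  intros Hf; change 4%nat with (2 + 2)%nat; rewrite <- Derive_n_comp.
  (* The inner second derivative is a quadratic, read as a quartic with vanishing top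
     coefficients. *)
  rewrite (Derive_n_2_quartic _ (2 * p2) (6 * p3) (12 * p4) 0 0); [ring|].
  intros t; rewrite (Derive_n_2_quartic f p0 p1 p2 p3 p4 t Hf); ring.
Qed.

Lemma partial_derive_snd (k : nat) (f : R -> R -> R) (x y : R) :
  partial_derive 0 k f x y = Derive_n (f x) k y.
Proof. reflexivity. Qed.

(** Squares are spelled as products so that [polynomial2_mult] applies directly. *)
Definition test_function (a b c d x y : R) : R :=
  (a * x + b * y) * (a * x + b * y) * ((c * x + d * y) * (c * x + d * y)).

Lemma test_function_smooth2 (a b c d : R) : smooth2 (test_function a b c d).
Proof.
  apply polynomial2_smooth2.
  assert (linear : forall p q, polynomial2 (fun x y => p * x + q * y)).
  { intros p q.
    apply (polynomial2_plus (fun x _ => p * x) (fun _ y => q * y)).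
    - apply (polynomial2_mult (fun _ _ => p) (fun x _ => x));
        constructor.
    - apply (polynomial2_mult (fun _ _ => q) (fun _ y => y));
        constructor. }
  apply (polynomial2_mult (fun x y => (a * x + b * y) * (a * x + b * y))
                          (fun x y => (c * x + d * y) * (c * x + d * y)));
    apply (polynomial2_mult (fun x y => _ * x + _ * y)
                            (fun x y => _ * x + _ * y)); apply linear.
Qed.

Lemma biharmonic_test_function (a b c d x y : R) :
  biharmonic (test_function a b c d) x y =
  8 * (a ^ 2 + b ^ 2) * (c ^ 2 + d ^ 2) + 16 * (a * c + b * d) ^ 2.
Proof.
  unfold biharmonic; rewrite partial_derive_snd.
  unfold partial_derive, test_function.
  (* Pure [x] derivative: the coefficients collect the test function in powers of the first variable
     at fixed [y]. *)
  rewrite (Derive_n_4_quartic _ (b^2 * d^2 * y^4)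
    (2 * (a * b * d^2 + b^2 * c * d) * y^3)
    ((a^2 * d^2 + 4 * a * b * c * d + b^2 * c^2) * y^2)
    (2 * (a^2 * c * d + a * b * c^2) * y) (a^2 * c^2))
    by (intros t; simpl; ring).
  (* Mixed term: the second [y] derivative is quadratic in the first variable. Its coefficients come
     from expanding in powers of the second variable, as done for the inner derivative below. *)
  rewrite (Derive_n_2_quartic _
    (12 * b^2 * d^2 * y^2) (12 * (a * b * d^2 + b^2 * c * d) * y)
    (2 * (a^2 * d^2 + 4 * a * b * c * d + b^2 * c^2)) 0 0).
  2: { intros t.
    rewrite (Derive_n_2_quartic _ (a^2 * c^2 * t^4)
      (2 * (a^2 * c * d + a * b * c^2) * t^3)
      ((a^2 * d^2 + 4 * a * b * c * d + b^2 * c^2) * t^2)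
      (2 * (a * b * d^2 + b^2 * c * d) * t) (b^2 * d^2))
      by (intros s; ring).
    ring. }
  rewrite (Derive_n_4_quartic _ (a^2 * c^2 * x^4)
    (2 * (a^2 * c * d + a * b * c^2) * x^3)
    ((a^2 * d^2 + 4 * a * b * c * d + b^2 * c^2) * x^2)
    (2 * (a * b * d^2 + b^2 * c * d) * x) (b^2 * d^2))
    by (intros t; ring).
  ring.
Qed.

Lemma sum_fourth_derivs_test_function (a b c d X Y : R) :
  a * d - b * c <> 0 ->
  sum_fourth_derivs (in_new_variables a b c d (test_function a b c d)) X Y = 0.
Proof.
  intros Hdet.
  assert (E : forall s t,
    in_new_variables a b c d (test_function a b c d) s t = s ^ 2 * t ^ 2).
  { intros s t; unfold in_new_variables, test_function; field; exact Hdet. }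
  unfold sum_fourth_derivs; rewrite partial_derive_snd; unfold partial_derive.
  (* With one variable fixed, [s ^ 2 * t ^ 2] is only quadratic in the other, so each fourth
     derivative vanishes. *)
  rewrite (Derive_n_4_quartic _ 0 0 (Y ^ 2) 0 0)
    by (intros t; simpl; rewrite E; ring).
  rewrite (Derive_n_4_quartic _ 0 0 (X ^ 2) 0 0)
    by (intros t; rewrite E; ring).
  ring.
Qed.

Theorem lemma3p1 :
  ~ exists a b c d : R,
      a * d - b * c <> 0 /\
      forall u : R -> R -> R, smooth2 u ->
        forall x y : R,
          biharmonic u x y =
          sum_fourth_derivs (in_new_variables a b c d u)
            (a * x + b * y) (c * x + d * y).
Proof.
  intros (a & b & c & d & Hdet & H).
  (* Both sides are constant in the point, so the origin is as good as any. *)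
  specialize (H _ (test_function_smooth2 a b c d) 0 0).
  rewrite biharmonic_test_function, sum_fourth_derivs_test_function in H
    by exact Hdet.
  (* Lagrange's identity bounds the bilaplacian below by [8 (a d - b c)^2]. *)
  assert (L : (a ^ 2 + b ^ 2) * (c ^ 2 + d ^ 2)
              = (a * d - b * c) ^ 2 + (a * c + b * d) ^ 2) by ring.
  pose proof (pow2_gt_0 _ Hdet).
  pose proof (pow2_ge_0 (a * c + b * d)).
  lra.
Qed.
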